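(* Let $\Sigma\in\mathbb R^{d\times d}$ be symmetric positive definite and let $\Psi\colon\mathbb R^d\to\mathbb R^d$ be Borel measurable with $|\Psi(u)|\le\kappa_\Psi$ for all $u\in\mathbb R^d$, where $\kappa_\Psi>0$. Then for all $\mu,\nu\in\mathcal P^2(\mathbb R^d)$, $$d_g(\mathsf P\mu,\mathsf P\nu)\le\bigl(1+\kappa_\Psi^2+\operatorname{tr}(\Sigma)\bigr)\,d_g(\mu,\nu).$$
   Context: $|\cdot|$ is the Euclidean norm and $|v|_\Sigma=|\Sigma^{-1/2}v|$. $\mathcal P^2(\mathbb R^n)$ is the set of Borel probability measures with finite second moment. With $g(v)=1+|v|^2$ on $\mathbb R^n$, $d_g(\mu_1,\mu_2)=\sup_{|f|\le g}\left|\int f\,d\mu_1-\int f\,d\mu_2\right|$ for $\mu_1,\mu_2\in\mathcal P^2(\mathbb R^n)$, the supremum being over measurable $f$ with $|f|\le g$ pointwise. For a probability measure $\mu$ on $\mathbb R^d$, $\mathsf P\mu$ is the probability measure with Lebesgue density $\mathsf P\mu(u)=\frac{1}{\sqrt{(2\pi)^d\det\Sigma}}\int_{\mathbb R^d}\exp\left(-\tfrac12|u-\Psi(v)|_\Sigma^2\right)\mu(dv)$. *)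

(* Defs.v *)
From HB Require Import structures.
From mathcomp Require Import all_boot all_order all_algebra.
From mathcomp Require Import all_classical all_reals all_analysis.
From mathcomp Require Import measurable_realfun.

Set Implicit Arguments.
Unset Strict Implicit.
Unset Printing Implicit Defensive.
Import Order.TTheory GRing.Theory Num.Theory.
Import numFieldNormedType.Exports.

Local Open Scope classical_set_scope.
Local Open Scope ring_scope.

(* Matrices, hence column vectors 'cV[R]_d, carry the Borel sigma-algebra of
   their canonical topology. *)
Section borel_matrix.
Context {R : realType} {m n : nat}.

Definition measurable_mx : set (set 'M[R]_(m, n)) :=
  <<s @open 'M[R]_(m, n) >>.

HB.instance Definition _ := @isMeasurable.Build
  (sigma_display (@open 'M[R]_(m, n))) 'M[R]_(m, n) measurable_mx
  (@sigma_algebra0 _ _ _) (@sigma_algebraC _ _)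
  (@sigma_algebra_bigcup _ _ _).

End borel_matrix.

Lemma measurable_mx_coord (R : realType) m n (i : 'I_m) (j : 'I_n) :
  measurable_fun [set: 'M[R]_(m, n)] (fun M : 'M[R]_(m, n) => M i j).
Proof.
apply: (measurability _ (RGenOpens.measurableE R)).
move=> _ [_ [a [b ->]] <-]; rewrite setTI; apply: sub_sigma_algebra.
apply: open_comp => [M _|]; first exact: coord_continuous.
exact: interval_open.
Qed.

Lemma measurable_fun_mxP (R : realType) d (T : measurableType d) m n
    (f : T -> 'M[R]_(m, n)) :
  measurable_fun [set: T] f <->
  forall i j, measurable_fun [set: T] (fun t => f t i j).
Proof.
split=> [mf i j|mf].
  exact: (measurableT_comp (measurable_mx_coord i j) mf).
apply: (@measurability _ _ _ _ _ f (@open 'M[R]_(m, n))) => //.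
move=> _ [U oU <-]; rewrite setTI.
pose B (p : 'M[rat]_(m, n) * nat) : set 'M[R]_(m, n) :=
  [set M | forall i j, `|ratr (p.1 i j) - M i j| < p.2.+1%:R^-1].
have -> : f @^-1` U = \bigcup_p (if `[< B p `<=` U >] then f @^-1` (B p)
                                  else set0).
  apply/seteqP; split=> [t Uft|t [p _]]; last first.
    by case: asboolP => // BU Bt; exact: BU.
  have /nbhs_ballP[e /= e0 eU] := open_nbhs_nbhs (conj oU Uft).
  have e20 : 0 < e / 2 by rewrite divr_gt0.
  have [k _ /(_ k (leqnn _)) /= ke] := near_infty_natSinv_lt (PosNum e20).
  have k0 : (0 : R) < k.+1%:R^-1 by rewrite invr_gt0.
  have q_ i j : exists q : rat, `|ratr q - f t i j| < k.+1%:R^-1.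
    have /rat_in_itvoo[q] : f t i j - k.+1%:R^-1 < f t i j + k.+1%:R^-1.
      by rewrite ltrBlDr -addrA ltrDl addr_gt0.
    by rewrite in_itv/= => qk; exists q; rewrite ltr_distl.
  pose Q : 'M[rat]_(m, n) := \matrix_(i, j) sval (cid (q_ i j)).
  have BQ : B (Q, k) (f t).
    by move=> i j /=; rewrite mxE; case: cid.
  exists (Q, k) => //; case: asboolP => // -[] M BM; apply: eU; split=> // i j.
  rewrite /ball/= (splitr e).
  rewrite (le_lt_trans (ler_distD (ratr (Q i j)) _ _))// ltrD//.
    by rewrite distrC; apply: lt_trans ke; exact: BQ.
  by apply: lt_trans ke; exact: BM.
apply: countable_bigcupT_measurable => // p; case: asboolP => // _.
have -> : f @^-1` B p = \bigcap_(ij in [set: 'I_m * 'I_n])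
    (fun t => `|ratr (p.1 ij.1 ij.2) - f t ij.1 ij.2|) @^-1` `]-oo, p.2.+1%:R^-1[.
  apply/seteqP; split=> [t Bt [i j] _|t Bt i j] /=; rewrite ?in_itv//=.
  by have := Bt (i, j) I; rewrite /= in_itv.
apply: fin_bigcap_measurable => // -[i j] _ /=.
rewrite -[X in measurable X]setTI.
have mh : measurable_fun [set: T] (fun t => `|ratr (p.1 i j) - f t i j|).
  by apply: measurableT_comp => //; apply: measurable_funB => //; exact: mf.
by apply: mh => //; exact: measurable_itv.
Qed.

(* Lebesgue measure on R^d is the d-fold product of Lebesgue measure on R: the
   vectors of R^(d+1) are col_mx x v with x in R and v in R^d, and R^0 is a
   point of mass 1. *)
Section lebesgue_cV.
Context {R : realType}.

Definition cons_cV d (p : R * 'cV[R]_d) : 'cV[R]_d.+1 :=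
  col_mx (p.1%:M : 'cV[R]_1) p.2.

Lemma cons_cV0 d (p : R * 'cV[R]_d) : cons_cV p ord0 ord0 = p.1.
Proof.
rewrite /cons_cV (_ : ord0 = lshift d (ord0 : 'I_1)); last exact: val_inj.
by rewrite (@col_mxEu _ 1 d 1) mxE eqxx.
Qed.

Lemma cons_cV_lift d (p : R * 'cV[R]_d) i :
  cons_cV p (lift ord0 i) ord0 = p.2 i ord0.
Proof.
rewrite /cons_cV (_ : lift ord0 i = rshift 1 i); last exact: val_inj.
by rewrite (@col_mxEd _ 1 d 1).
Qed.

Lemma measurable_cons_cV d : measurable_fun [set: R * 'cV[R]_d] (@cons_cV d).
Proof.
apply/measurable_fun_mxP => i j.
rewrite (_ : (fun _ => _) = fun p : R * 'cV[R]_d =>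
  match fintype.split (i : 'I_(1 + d)) with inl _ => p.1 | inr k => p.2 k j end).
  case: fintype.split => [_|k]; first exact: measurable_fst.
  exact: (measurableT_comp (measurable_mx_coord k j) measurable_snd).
apply/funext => p; rewrite /cons_cV mxE; case: fintype.split => [k|//].
by rewrite mxE !ord1 eqxx.
Qed.

Definition lebesgue_cons d (mu : {sigma_finite_measure set 'cV[R]_d -> \bar R})
    : set 'cV[R]_d.+1 -> \bar R :=
  pushforward (@lebesgue_measure R \x mu)%E (@cons_cV d).

Section lebesgue_cons_measure.
Variables (d : nat) (mu : {sigma_finite_measure set 'cV[R]_d -> \bar R}).

Let pushforward_measure : {measure set 'cV[R]_d.+1 -> \bar R} :=
  measure_function_pushforward__canonical__measure_function_Measure
    (@lebesgue_measure R \x mu)%E (@measurable_cons_cV d).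

Let lebesgue_cons0 : lebesgue_cons mu set0 = 0%E.
Proof. exact: (measure0 pushforward_measure). Qed.

Let lebesgue_cons_ge0 A : (0 <= lebesgue_cons mu A)%E.
Proof. exact: (measure_ge0 pushforward_measure). Qed.

Let lebesgue_cons_sigma_additive : semi_sigma_additive (lebesgue_cons mu).
Proof. exact: (@measure_semi_sigma_additive _ _ _ pushforward_measure). Qed.

HB.instance Definition _ := isMeasure.Build _ _ _ (lebesgue_cons mu)
  lebesgue_cons0 lebesgue_cons_ge0 lebesgue_cons_sigma_additive.

Let lebesgue_cons_sigma_finite : sigma_finite setT (lebesgue_cons mu).
Proof.
have [F FT Foo] : sigma_finite setT (@lebesgue_measure R \x mu)%E.
  have /sigma_finiteP[F [TF ndF Foo]] := sigma_finiteT (@lebesgue_measure R).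
  have /sigma_finiteP[G [TG ndG Goo]] := sigma_finiteT mu.
  exists (fun n => F n `*` G n).
    rewrite -setXTT TF TG predeqE => -[x y]; split; last first.
      by move=> [n _ []/= ? ?]; split; exists n.
    move=> [/= [n _ Fnx] [k _ Gky]]; exists (maxn n k) => //; split.
      by move: x Fnx; exact/subsetPset/ndF/leq_maxl.
    by move: y Gky; exact/subsetPset/ndG/leq_maxr.
  move=> k; have [? ?] := Foo k; have [? ?] := Goo k.
  split; first exact: measurableX.
  by rewrite product_measure1E// lte_mul_pinfty// ge0_fin_numE.
pose g (v : 'cV[R]_d.+1) : R * 'cV[R]_d :=
  (v (lshift d ord0 : 'I_(1 + d)) ord0, dsubmx (v : 'cV[R]_(1 + d))).
have cK : cancel (@cons_cV d) g.
  move=> [x v]; rewrite /g /cons_cV col_mxKd; congr pair.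
  by rewrite (@col_mxEu _ 1 d 1) mxE eqxx.
have mg : measurable_fun setT g.
  apply/measurable_fun_pairP; split; first exact: measurable_mx_coord.
  apply/measurable_fun_mxP => i j.
  rewrite (_ : (fun _ => _) = fun v : 'cV[R]_d.+1 =>
    v (rshift 1 i : 'I_(1 + d)) j); first exact: measurable_mx_coord.
  by apply/funext => v; rewrite /= mxE.
exists (fun i => g @^-1` F i).
  by rewrite -preimage_bigcup -FT preimage_setT.
move=> i; have [mFi Fioo] := Foo i; split.
  by rewrite -[X in measurable X]setTI; exact: mg.
rewrite /lebesgue_cons /pushforward -comp_preimage.
by rewrite (_ : g \o _ = id) //; apply/funext => p /=; rewrite cK.
Qed.

HB.instance Definition _ := @Measure_isSigmaFinite.Build _ _ _
  (lebesgue_cons mu) lebesgue_cons_sigma_finite.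

End lebesgue_cons_measure.

Fixpoint lebesgue_cV d : {sigma_finite_measure set 'cV[R]_d -> \bar R} :=
  match d with
  | 0 => @dirac _ 'cV[R]_0 0 R
  | d'.+1 => lebesgue_cons (lebesgue_cV d')
  end.

(* The property characterizing Lebesgue measure on R^d. *)
Lemma lebesgue_cV_box d (A : 'I_d -> set R) :
  (forall i, measurable (A i)) ->
  lebesgue_cV d [set v | forall i, A i (v i ord0)] =
  (\prod_(i < d) lebesgue_measure (A i))%E.
Proof.
elim: d A => [|d IHd] A mA /=.
  by rewrite big_ord0 diracE mem_set// => -[].
rewrite big_ord_recl -IHd; last by move=> i; exact: mA.
rewrite -product_measure1E; [|exact: mA|]; last first.
  rewrite [X in measurable X](_ : _ = \bigcap_(i in [set: 'I_d])
      (fun v : 'cV[R]_d => v i ord0) @^-1` A (lift ord0 i)); last first.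
    by apply/seteqP; split => v /= h i; [move=> _|]; exact: h.
  apply: fin_bigcap_measurable => // i _; rewrite -[X in measurable X]setTI.
  by apply: measurable_mx_coord.
rewrite /lebesgue_cons /pushforward; congr (product_measure1 _ _ _).
apply/seteqP; split => -[x v] /= h.
  split; first by have := h ord0; rewrite cons_cV0.
  by move=> i; have := h (lift ord0 i); rewrite cons_cV_lift.
case: h => xA vA i; case: (unliftP ord0 i) => [j|] ->.
  by rewrite cons_cV_lift; exact: vA.
by rewrite cons_cV0.
Qed.

End lebesgue_cV.

Section definitions.
Context {R : realType}.
Local Open Scope ereal_scope.

Definition enorm {d} (v : 'cV[R]_d) : R :=
  Num.sqrt (\sum_(i < d) v i ord0 ^+ 2)%R.

Definition sym_posdefmx d (S : 'M[R]_d) : Prop :=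
  S^T = S /\
  forall v : 'cV[R]_d, v != 0%R -> (0 < (v^T *m S *m v) ord0 ord0)%R.

(* The symmetric positive definite square root of S; it exists and is unique
   when S is symmetric positive definite, and 0 is a dummy value otherwise. *)
Definition sqrtmx d (S : 'M[R]_d) : 'M[R]_d :=
  xget 0%R [set T | sym_posdefmx T /\ T *m T = S].

(* |v|_S = |S^(-1/2) v|, where S^(-1/2) is the inverse of S^(1/2). *)
Definition wnorm d (S : 'M[R]_d) (v : 'cV[R]_d) : R :=
  enorm (invmx (sqrtmx S) *m v).

Definition finite_second_moment d (mu : {measure set 'cV[R]_d -> \bar R}) :=
  \int[mu]_v (enorm v ^+ 2)%:E < +oo.

Definition gweight {d} (v : 'cV[R]_d) : R := (1 + enorm v ^+ 2)%R.

(* On measures with finite mass and finite second moment all the integrals below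
   are finite, so that their difference in \bar R is the real one. *)
Definition d_g d (mu1 mu2 : {measure set 'cV[R]_d -> \bar R}) : \bar R :=
  ereal_sup [set `|\int[mu1]_v (f v)%:E - \int[mu2]_v (f v)%:E|
            | f in [set f : 'cV[R]_d -> R |
                measurable_fun setT f /\ forall v, (`|f v| <= gweight v)%R]].

Section transition.
Variables (d : nat) (Sigma : 'M[R]_d) (Psi : {mfun 'cV[R]_d >-> 'cV[R]_d}).

Definition markovP_density (mu : probability 'cV[R]_d R) (u : 'cV[R]_d) : \bar R :=
  ((Num.sqrt ((2 * pi) ^+ d * \det Sigma))^-1)%:E *
  \int[mu]_v (expR (- (2^-1 * wnorm Sigma (u - Psi v) ^+ 2)))%:E.

Definition markovP (mu : probability 'cV[R]_d R) : set 'cV[R]_d -> \bar R :=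
  fun A => \int[lebesgue_cV d]_(u in A) markovP_density mu u.

Variable mu : probability 'cV[R]_d R.

Lemma markovP_density_ge0 u : 0 <= markovP_density mu u.
Proof.
apply: mule_ge0; first by rewrite lee_fin invr_ge0 sqrtr_ge0.
by apply: integral_ge0 => v _; rewrite lee_fin expR_ge0.
Qed.

Lemma measurable_markovP_density : measurable_fun setT (markovP_density mu).
Proof.
apply: measurable_funeM.
pose f (p : 'cV[R]_d * 'cV[R]_d) : \bar R :=
  (expR (- (2^-1 * wnorm Sigma (p.1 - Psi p.2) ^+ 2)))%:E.
apply: (@measurable_fun_fubini_tonelli_F _ _ _ _ _ mu f) => [|p]; last first.
  by rewrite lee_fin expR_ge0.
have mcoord i : measurable_fun setT
    (fun p : 'cV[R]_d * 'cV[R]_d => (p.1 - Psi p.2)%R i ord0).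
  rewrite (_ : (fun _ => _) = fun p : 'cV[R]_d * 'cV[R]_d =>
    (p.1 i ord0 - Psi p.2 i ord0)%R); last first.
    by apply/funext => p; rewrite !mxE.
  apply: measurable_funB.
    exact: (measurableT_comp (measurable_mx_coord i ord0) measurable_fst).
  apply: (measurableT_comp (measurable_mx_coord i ord0)).
  exact: measurableT_comp.
apply/measurable_EFinP; apply: measurableT_comp => //.
apply: measurableT_comp => //; apply: measurable_funM => //.
apply: measurable_funX; apply: (measurableT_comp (continuous_measurable_fun (@sqrt_continuous R))).
apply: measurable_sum => i; apply: measurable_funX.
rewrite (_ : (fun _ => _) = fun p : 'cV[R]_d * 'cV[R]_d => \sum_j
   invmx (sqrtmx Sigma) i j * (p.1 - Psi p.2)%R j ord0)%R; last first.
  by apply/funext => p; rewrite mxE.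
by apply: measurable_sum => j; apply: measurable_funM.
Qed.

Let markovP0 : markovP mu set0 = 0.
Proof. exact: integral_set0. Qed.

Let markovP_ge0 A : 0 <= markovP mu A.
Proof. by apply: integral_ge0 => u _; exact: markovP_density_ge0. Qed.

Let markovP_sigma_additive : semi_sigma_additive (markovP mu).
Proof.
move=> F mF tF mUF; rewrite /markovP ge0_integral_bigcup//.
- by apply: is_cvg_ereal_nneg_natsum_cond => n _ _; exact: markovP_ge0.
- exact: measurable_funTS measurable_markovP_density.
- by move=> u _; exact: markovP_density_ge0.
Qed.

HB.instance Definition _ := isMeasure.Build _ _ _ (markovP mu)
  markovP0 markovP_ge0 markovP_sigma_additive.

End transition.
End definitions.

(* Main.v *)
Require Import Defs.
From HB Require Import structures.
From mathcomp Require Import all_boot all_order all_algebra.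
From mathcomp Require Import all_classical all_reals all_analysis.
From mathcomp Require Import measurable_realfun.
From mathcomp Require Import complex.
From mathcomp Require Import ring lra.

(** Why the estimate holds.  Write N(m, Sigma) for the Gaussian law of mean m
    and covariance Sigma.  Integrating a function f against P mu amounts to
    integrating against mu the function q(v) = E[f(U)], where U has law
    N(Psi v, Sigma); this is Tonelli's theorem, applied to the positive and
    negative parts of f ([integral_markovP_bounded]).  If |f| <= g, then
    |q(v)| <= E[g(U)] = 1 + |Psi v|^2 + tr Sigma <= K, where
    K = 1 + kappa^2 + tr Sigma.  So q / K is bounded by 1, hence by g, and is a
    competitor in the supremum that defines d_g mu nu.  Since q depends neither
    on mu nor on nu, the inequality follows by scaling.

    The analytic content is the bound E[g(U)] <= 1 + |m|^2 + tr Sigma for U of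
    law N(m, Sigma) ([gaussian_mean_gweight_le]); only this inequality is
    proved.  Put T = Sigma^(1/2) and substitute u = m + T z: the density becomes
    the product of standard normal densities and the integrand a sum of squares
    of affine functions of z, so that everything reduces to
      E[(a + t . Z)^2] <= a^2 + |t|^2   for Z standard normal
    ([integral_affine_sqr_gauss_cV_le]), which follows from the one-dimensional
    case by induction on the dimension.  Three auxiliary theories are needed.

    - Square roots: a symmetric positive definite matrix is diagonalizable with
      positive eigenvalues, by the spectral theorem over the complex numbers.
      A real polynomial interpolating the fourth root at these eigenvalues then
      yields a square root that is real, symmetric and positive definite
      ([sym_posdefmx_sqrt]).
    - Change of variables in R^d: since only a positive definite T occurs, the
      factorization given by a Schur complement needs no pivoting, and the
      formula follows by induction on d from Tonelli's theorem, translation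
      invariance and scaling on the line ([ge0_integral_cV_linear]).
    - The one-dimensional second moment: integrating
      1 + s x^2 <= exp(s x^2) against exp(- x^2 / 2) bounds it by Gaussian
      integrals of other variances; letting s tend to 0 gives the sharp
      constant ([integral_sqr_gauss_le]). *)

Set Implicit Arguments.
Unset Strict Implicit.
Unset Printing Implicit Defensive.
Import Order.TTheory GRing.Theory Num.Theory.
Import numFieldNormedType.Exports.

Local Open Scope classical_set_scope.
Local Open Scope ring_scope.

(** * Square roots of symmetric positive definite matrices *)

Lemma poly_interpolation (F : fieldType) (f : F -> F) (s : seq F) :
  exists p : {poly F}, forall x, x \in s -> p.[x] = f x.
Proof.
elim: s => [|a s [p ps]]; first by exists 0.
have [as_|aNs] := boolP (a \in s).
  by exists p => x; rewrite inE => /predU1P[->|]; exact: ps.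
pose w := \prod_(b <- s) ('X - b%:P).
have w_root x : x \in s -> w.[x] = 0.
  by move=> xs; apply/rootP; rewrite root_prod_XsubC.
have wa : w.[a] != 0 by rewrite -/(root w a) root_prod_XsubC.
exists (p + ((f a - p.[a]) / w.[a]) *: w) => x; rewrite !hornerE.
rewrite inE => /predU1P[->|xs]; first by rewrite divfK// subrKC.
by rewrite (w_root _ xs) mulr0 addr0 ps.
Qed.

Lemma trmx_horner_mx (R : comNzRingType) n (A : 'M[R]_n.+1) (p : {poly R}) :
  (horner_mx A p)^T = horner_mx A^T p.
Proof.
elim/poly_ind: p => [|p c IHp]; first by rewrite !rmorph0 trmx0.
rewrite !rmorphD !rmorphM/= !horner_mx_X !horner_mx_C linearD/= trmx_mul IHp.
by rewrite tr_scalar_mx comm_mx_horner.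
Qed.

Lemma trmx_self_mul (R : realDomainType) n (v : 'cV[R]_n) :
  (v^T *m v) ord0 ord0 = \sum_i v i ord0 ^+ 2.
Proof. by rewrite mxE; apply: eq_bigr => i _; rewrite mxE. Qed.

Lemma sqnorm_gt0 (R : realDomainType) n (v : 'cV[R]_n) :
  v != 0 -> 0 < \sum_i v i ord0 ^+ 2.
Proof.
move=> v0; rewrite lt_neqAle sumr_ge0 ?andbT => [|i _]; last exact: sqr_ge0.
apply: contra v0; rewrite eq_sym psumr_eq0 => [/allP vi0|i _]; last exact: sqr_ge0.
apply/eqP/matrixP => i j; rewrite ord1 mxE; apply/eqP.
by have := vi0 i; rewrite mem_index_enum sqrf_eq0; exact.
Qed.

Section sqrt.
Context {R : realType}.

Lemma sym_posdefmx_eigenvalue n (S : 'M[R]_n) (a : R) :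
  sym_posdefmx S -> eigenvalue S a -> 0 < a.
Proof.
move=> [symS posS] /eigenvalueP[v vS v0].
have w0 : v^T != 0 by rewrite -trmx0 (inj_eq trmx_inj).
have := posS _ w0; rewrite trmxK vS -scalemxAl mxE.
rewrite -{1}[v]trmxK trmx_self_mul pmulr_lgt0//; exact: sqnorm_gt0.
Qed.

(** The list [s] is the spectrum.  Over the complex numbers [S] is similar to a
    diagonal matrix, so a polynomial that vanishes on the spectrum annihilates
    [S]; as the eigenvalues are real, this descends to real polynomials. *)
Lemma sym_posdefmx_annihilated n (S : 'M[R]_n.+1) : sym_posdefmx S ->
  exists s : seq R, (forall a, a \in s -> 0 < a) /\
    forall p : {poly R}, (forall a, a \in s -> p.[a] = 0) -> horner_mx S p = 0.
Proof.
move=> spdS; have [symS _] := spdS.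
pose toC : {rmorphism R -> R[i]} := real_complex R; pose A := map_mx toC S.
have Areal : A \is a mxOver Num.real.
  by apply/mxOverP => i j; rewrite mxE; apply/complex_realP; exists (S i j).
have Asym : A \is symmetricmx.
  apply/is_hermitianmxP; rewrite expr0 scale1r; apply/matrixP => i j.
  by rewrite !mxE -[in LHS]symS mxE.
have Aherm := realsym_hermsym Asym Areal.
have /orthomx_spectralP := hermitian_normalmx Aherm.
have := hermitian_spectral_diag_real Aherm; have := spectral_unit A.
move: (spectralmx A) (spectral_diag A) => P D Punit Dre AE.
have PA : P *m A = diag_mx D *m P by rewrite [in LHS]AE !mulmxA mulmxV// mul1mx.
have Dreal i : exists l : R, D 0 i = toC l.
  by apply/complex_realP; exact/mxOverP.
have Deig i : eigenvalue A (D 0 i).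
  apply/eigenvalueP; exists (row i P).
    by rewrite -row_mul PA mul_diag_mx; apply/rowP => j; rewrite !mxE.
  apply/eqP => Pi0; have := congr1 (mulmxr (invmx P)) Pi0.
  rewrite /= -row_mul mulmxV// mul0mx => /rowP/(_ i).
  by rewrite !mxE eqxx => /eqP; rewrite oner_eq0.
have {}Dreal i : D 0 i = toC (complex.Re (D 0 i)).
  by have [l ->] := Dreal i.
exists [seq complex.Re (D 0 i) | i : 'I_n.+1]; split=> [_ /mapP[i _ ->]|p p0].
  apply: (sym_posdefmx_eigenvalue spdS).
  by have := Deig i; rewrite Dreal eigenvalue_map.
apply: (@map_mx_inj _ _ toC).
rewrite map_horner_mx -/A [in LHS]AE map_mx0 horner_mx_uconjC//.
rewrite horner_mx_diag (_ : map_mx _ D = 0); first by rewrite linear0 mulmx0 mul0mx.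
apply/rowP => i; rewrite !mxE Dreal horner_map p0 ?rmorph0//.
by apply/mapP; exists i; rewrite // mem_enum.
Qed.

(** The root is [r(S) ^ 2] where [r] interpolates the fourth root on the
    spectrum: its square is [S] because [r ^ 4 - X] vanishes on the spectrum,
    and being the square of a symmetric invertible matrix it is positive
    definite. *)
Lemma sym_posdefmx_sqrt n (S : 'M[R]_n) :
  sym_posdefmx S -> exists T : 'M[R]_n, sym_posdefmx T /\ T *m T = S.
Proof.
case: n S => [|n] S spdS.
  by exists S; split=> //; apply/matrixP => -[].
have [s [s_gt0 sS]] := sym_posdefmx_annihilated spdS.
have [symS posS] := spdS.
have [r rs] := poly_interpolation (fun x => Num.sqrt (Num.sqrt x)) s.
pose Q := horner_mx S r.
have symQ : Q^T = Q by rewrite trmx_horner_mx symS.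
have Q4 : (Q *m Q) *m (Q *m Q) = S.
  have -> : (Q *m Q) *m (Q *m Q) = horner_mx S (r * r * (r * r)).
    by rewrite !rmorphM.
  rewrite -[RHS](horner_mx_X S).
  apply/eqP; rewrite -subr_eq0 -rmorphB; apply/eqP/sS => a /[dup] /s_gt0/ltW a0 /rs.
  rewrite hornerD hornerN hornerX !hornerM => ->.
  by rewrite -!expr2 !sqr_sqrtr ?sqrtr_ge0// subrr.
exists (Q *m Q); split=> //; split=> [|v v0]; first by rewrite trmx_mul symQ.
rewrite mulmxA -{1}symQ -trmx_mul -mulmxA trmx_self_mul; apply: sqnorm_gt0.
apply: contraTneq (posS v v0) => Qv.
by rewrite -mulmxA -Q4 -!mulmxA Qv !mulmx0 mxE ltxx.
Qed.

Lemma sqrtmxP n (S : 'M[R]_n) : sym_posdefmx S ->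
  sym_posdefmx (sqrtmx S) /\ sqrtmx S *m sqrtmx S = S.
Proof.
move=> /sym_posdefmx_sqrt[T hT].
exact: (@xgetPex _ 0 [set T | sym_posdefmx T /\ T *m T = S] (ex_intro _ T hT)).
Qed.

(** One step of Gaussian elimination: [S] is the Schur complement of the pivot
    [a].  Both are positive because they are values of the quadratic form of
    [T], at the first basis vector for [a] and, for [S], at the vector extending
    [v] that minimizes the form. *)
Lemma sym_posdefmx_block n (T : 'M[R]_(1 + n)) : sym_posdefmx T ->
  exists (a : R) (c : 'cV[R]_n) (S : 'M[R]_n),
    [/\ 0 < a, sym_posdefmx S &
        T = block_mx a%:M c^T c (S + a^-1 *: (c *m c^T))].
Proof.
move=> [symT posT].
pose a := T ord0 ord0; pose c := dlsubmx T; pose B := drsubmx T.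
have TE : T = block_mx a%:M c^T c B.
  rewrite -[LHS]submxK; congr block_mx.
    rewrite [LHS]mx11_scalar /a; congr (_ %:M); rewrite !mxE.
    by congr (T _ _); exact: val_inj.
  by rewrite /c -{1}symT trmx_dlsub.
have symB : B^T = B by rewrite /B trmx_drsub symT.
have quad (x : 'M[R]_1) (v : 'cV_n) :
    (col_mx x v)^T *m T *m col_mx x v =
    x^T *m (a%:M *m x + c^T *m v) + v^T *m (c *m x + B *m v).
  by rewrite -mulmxA TE mul_block_col tr_col_mx mul_row_col.
have a0 : 0 < a.
  have e0 : col_mx 1%:M 0 != 0 :> 'cV[R]_(1 + n).
    apply/eqP => /(congr1 usubmx); rewrite col_mxKu => /matrixP/(_ 0 0).
    by rewrite !mxE => /eqP; rewrite oner_eq0.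
  by have := posT _ e0; rewrite quad !mulmx0 trmx0 mul0mx !addr0 trmx1 mul1mx mulmx1 mxE eqxx.
exists a, c, (B - a^-1 *: (c *m c^T)); split=> //; last by rewrite subrK.
split; first by rewrite linearB/= symB linearZ/= trmx_mul trmxK.
move=> v v0.
(* the minimizer over x of the form of T at (x, v) *)
pose x : 'M[R]_1 := - (a^-1 *: (c^T *m v)).
have xv0 : col_mx x v != 0.
  by apply: contra_neq v0 => /(congr1 dsubmx); rewrite col_mxKd linear0.
have := posT _ xv0; rewrite quad /x.
rewrite mul_scalar_mx scalerN scalerA divff ?gt_eqF// scale1r addNr mulmx0 add0r.
rewrite mulmxN -scalemxAr -mulmxA mulmxBl -scalemxAl mulmxA addrC.
by rewrite -mulmxA.
Qed.

End sqrt.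

(** * Affine changes of variable on the line *)

Section lebesgue_line.
Context {R : realType}.
Local Notation leb := (@lebesgue_measure R).
Local Open Scope ereal_scope.

Let affine (a b : R) : measurableTypeR R -> measurableTypeR R :=
  fun x => (a * x + b)%R.

Let measurable_affine a b : measurable_fun setT (affine a b).
Proof. by apply: measurable_funD => //; exact: measurable_funM. Qed.

(** Up to the factor [a], the image of Lebesgue measure by the affine map gives
    half-open intervals their length, which characterizes Lebesgue measure. *)
Lemma lebesgue_measure_affine (a b : R) (A : set R) : (0 < a)%R ->
  measurable A ->
  leb (affine a b @^-1` A) = a^-1%:E * leb A.
Proof.
move=> a0 mA; have a0' := ltW a0.
pose push : {measure set (measurableTypeR R) -> \bar R} :=
  measure_function_pushforward__canonical__measure_function_Measure
    leb (measurable_affine a b).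
pose m := mscale (NngNum a0') push.
suff -> : leb A = m A.
  by rewrite /m/= /mscale/= muleA -EFinM mulVf ?gt_eqF// mul1e.
apply: lebesgue_measure_unique => //= _ [[p q]] _ <-.
rewrite /m /mscale/= /pushforward.
rewrite (_ : _ @^-1` _ = `](p - b) / a, (q - b) / a]%classic)%R; last first.
  apply/seteqP; split=> x; rewrite /= /affine !in_itv/=;
    by rewrite ltr_pdivrMr// ler_pdivlMr// ltrBlDr lerBrDr mulrC.
rewrite !lebesgue_measure_itv/= !lte_fin ltr_pM2r ?invr_gt0// ltrD2r.
case: ifPn => _; last by rewrite mule0.
by rewrite -EFinB -EFinM; congr EFin; field; rewrite gt_eqF.
Qed.

Lemma ge0_integral_affine (a b : R) (F : R -> \bar R) : (0 < a)%R ->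
  measurable_fun [set: R] F -> (forall x, 0 <= F x) ->
  \int[leb]_x F (a * x + b)%R = a^-1%:E * \int[leb]_x F x.
Proof.
move=> a0 mF F0; have a0' : (0 <= a^-1)%R by rewrite invr_ge0 ltW.
rewrite -[LHS](@ge0_integral_pushforward _ _ _ _ _ _
  (measurable_affine a b) leb setT F)//.
rewrite -[X in X%:E]/((NngNum a0')%:num) -ge0_integral_mscale//.
apply: eq_measure_integral => A mA _.
exact: lebesgue_measure_affine.
Qed.

Lemma ge0_integral_opp (F : R -> \bar R) :
  measurable_fun [set: R] F -> (forall x, 0 <= F x) ->
  \int[leb]_x F (- x)%R = \int[leb]_x F x.
Proof.
move=> mF F0.
have mN : measurable_fun setT (-%R : measurableTypeR R -> measurableTypeR R).
  exact: oppr_measurable.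
rewrite -[LHS](@ge0_integral_pushforward _ _ _ _ _ _ mN leb setT F)//.
by apply: eq_measure_integral => A mA _; exact: lebesgue_measureN.
Qed.

End lebesgue_line.

(** * Linear changes of variable in R^d *)

Section measurable_vectors.
Context {R : realType} {disp : measure_display} {T : measurableType disp}.

Lemma measurable_fun_coord d (f : T -> 'cV[R]_d) i :
  measurable_fun setT f -> measurable_fun setT (fun t => f t i ord0).
Proof. by move=> /measurable_fun_mxP; exact. Qed.

Lemma measurable_fun_addmx d (f g : T -> 'cV[R]_d) :
  measurable_fun setT f -> measurable_fun setT g ->
  measurable_fun setT (fun t => f t + g t).
Proof.
move=> /measurable_fun_mxP mf /measurable_fun_mxP mg; apply/measurable_fun_mxP => i j.
rewrite (_ : (fun _ => _) = fun t => f t i j + g t i j); last first.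
  by apply/funext => t; rewrite mxE.
exact: measurable_funD.
Qed.

Lemma measurable_fun_scalemx d (f : T -> R) (v : 'cV[R]_d) :
  measurable_fun setT f -> measurable_fun setT (fun t => f t *: v).
Proof.
move=> mf; apply/measurable_fun_mxP => i j.
rewrite (_ : (fun _ => _) = fun t => f t * v i j); last first.
  by apply/funext => t; rewrite mxE.
exact: measurable_funM.
Qed.

Lemma measurable_fun_mulmx n d (A : 'M[R]_(n, d)) (f : T -> 'cV[R]_d) :
  measurable_fun setT f -> measurable_fun setT (fun t => A *m f t).
Proof.
move=> /measurable_fun_mxP mf; apply/measurable_fun_mxP => i j.
rewrite (_ : (fun _ => _) = fun t => \sum_k A i k * f t k j); last first.
  by apply/funext => t; rewrite mxE.
by apply: measurable_sum => k; exact: measurable_funM.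
Qed.

Lemma measurable_fun_cons_cV d (f : T -> R) (g : T -> 'cV[R]_d) :
  measurable_fun setT f -> measurable_fun setT g ->
  measurable_fun setT (fun t => cons_cV (f t, g t)).
Proof.
move=> mf mg; apply: (measurableT_comp (@measurable_cons_cV R d)).
exact/measurable_fun_pairP.
Qed.

Lemma measurable_fun_enorm2 d (f : T -> 'cV[R]_d) :
  measurable_fun setT f -> measurable_fun setT (fun t => \sum_i f t i ord0 ^+ 2).
Proof.
move=> mf; apply: measurable_sum => i; apply: measurable_funX.
exact: measurable_fun_coord.
Qed.

End measurable_vectors.

Section lebesgue_vectors.
Context {R : realType}.
Local Notation leb := (@lebesgue_measure R).
Local Open Scope ereal_scope.

Section cons.
Variables (d : nat) (F : 'cV[R]_d.+1 -> \bar R).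
Hypotheses (mF : measurable_fun setT F) (F0 : forall z, 0 <= F z).

Let Fcons (p : measurableTypeR R * 'cV[R]_d) := F (cons_cV p).

Let mFcons : measurable_fun setT Fcons.
Proof. exact: measurableT_comp mF (@measurable_cons_cV R d). Qed.

Let integral_cons : \int[lebesgue_cV d.+1]_z F z =
  \int[(leb \x lebesgue_cV d)%E]_p Fcons p.
Proof.
have mcons : measurable_fun setT
    (@cons_cV R d : measurableTypeR R * 'cV[R]_d -> 'cV[R]_d.+1).
  exact: measurable_cons_cV.
by rewrite -[RHS](ge0_integral_pushforward mcons _ measurableT mF (in1W F0)).
Qed.

Lemma integral_lebesgue_cons : \int[lebesgue_cV d.+1]_z F z =
  \int[leb]_x \int[lebesgue_cV d]_v F (cons_cV (x, v)).
Proof. by rewrite integral_cons (fubini_tonelli1 Fcons mFcons (fun=> F0 _)). Qed.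

Lemma integral_lebesgue_cons_sym : \int[lebesgue_cV d.+1]_z F z =
  \int[lebesgue_cV d]_v \int[leb]_x F (cons_cV (x, v)).
Proof. by rewrite integral_cons (fubini_tonelli2 Fcons mFcons (fun=> F0 _)). Qed.

Lemma measurable_integral_lebesgue_cons :
  measurable_fun setT (fun x => \int[lebesgue_cV d]_v F (cons_cV (x, v))).
Proof. exact: (measurable_fun_fubini_tonelli_F Fcons mFcons (fun=> F0 _)). Qed.

End cons.

Lemma cons_cVD d (p q : R * 'cV[R]_d) :
  (cons_cV p + cons_cV q = cons_cV (p.1 + q.1, p.2 + q.2))%R.
Proof.
rewrite /cons_cV (raddfD (@scalar_mx R 1)).
exact: (@add_col_mx _ 1 d 1 p.1%:M p.2 q.1%:M q.2).
Qed.

Lemma cons_cV_surj d (z : 'cV[R]_d.+1) : exists p, z = cons_cV p.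
Proof.
exists (z ord0 ord0, dsubmx (z : 'cV_(1 + d))); rewrite /cons_cV /=.
rewrite -[LHS](vsubmxK (z : 'cV_(1 + d))) [usubmx _]mx11_scalar.
suff -> : usubmx (z : 'cV_(1 + d)) 0%R 0%R = z ord0 ord0 by [].
by rewrite mxE; congr (z _ _); exact: val_inj.
Qed.

Lemma block_mx_cons_cV d (a : R) (r : 'rV[R]_d) c B p :
  ((block_mx a%:M r c B : 'M[R]_d.+1) *m cons_cV p =
   cons_cV (a * p.1 + (r *m p.2) ord0 ord0, p.1 *: c + B *m p.2))%R.
Proof.
apply: etrans (mul_block_col (a%:M : 'M[R]_1) r c B (p.1%:M : 'M[R]_1) p.2) _.
have rp : ((r *m p.2) ord0 ord0)%:M = r *m p.2 :> 'M[R]_1.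
  exact/esym/mx11_scalar.
by rewrite /cons_cV /= (raddfD (@scalar_mx R 1)) /= rp scalar_mxM !mul_mx_scalar.

Qed.

Lemma ge0_integral_cV_translation d (m : 'cV[R]_d) (F : 'cV[R]_d -> \bar R) :
  measurable_fun setT F -> (forall z, 0 <= F z) ->
  \int[lebesgue_cV d]_z F (m + z)%R = \int[lebesgue_cV d]_z F z.
Proof.
elim: d m F => [|d IHd] m F mF F0.
  by apply: eq_integral => z _; congr F; apply/matrixP => -[].
have [[a m'] ->] := cons_cV_surj m.
rewrite integral_lebesgue_cons//; last first.
  by apply: (measurableT_comp mF); exact: measurable_fun_addmx.
rewrite integral_lebesgue_cons//.
under eq_integral => x _ do under eq_integral => v _ do rewrite cons_cVD/=.
under eq_integral => x _.
  rewrite (IHd m' (fun v => F (cons_cV (a + x, v))%R))//; last first.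
    by apply: (measurableT_comp mF); exact: measurable_fun_cons_cV.
  rewrite -{1}[x]mul1r addrC.
  over.
rewrite (ge0_integral_affine a (F := fun x => \int[lebesgue_cV d]_v F (cons_cV (x, v))))//.
- by rewrite invr1 mul1e.
- exact: measurable_integral_lebesgue_cons.
- by move=> x; apply: integral_ge0.
Qed.

(** In the notation of [sym_posdefmx_block], [T] maps [(x, v)] to
    [(y, (y / a) c + S v)] with [y = a x + c^T v].  Integrating in [x] first, at
    fixed [v], turns [x] into [y] at the cost of the factor [1 / a]; then, at
    fixed [y], the induction hypothesis for [S] and translation by [(y / a) c]
    handle [v].  The factors multiply to [1 / det T] since
    [det T = a * det S].  Positivity of the determinant comes from the same
    induction. *)
Lemma ge0_integral_cV_linear d (T : 'M[R]_d) (F : 'cV[R]_d -> \bar R) :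
  sym_posdefmx T ->
  measurable_fun setT F -> (forall z, 0 <= F z) ->
  (0 < \det T)%R /\
  \int[lebesgue_cV d]_z F (T *m z)%R =
    (\det T)^-1%:E * \int[lebesgue_cV d]_z F z.
Proof.
elim: d T F => [|d IHd] T F spdT mF F0.
  rewrite det_mx00 ltr01 invr1 mul1e; split=> //.
  by apply: eq_integral => z _; congr F; apply/matrixP => -[].
have [a [c [S [a0 spdS TE]]]] := sym_posdefmx_block spdT.
pose H (y : measurableTypeR R) (v : 'cV[R]_d) := F (cons_cV (y, (y / a) *: c + v))%R.
have mH2 : measurable_fun setT (fun p : measurableTypeR R * 'cV[R]_d => H p.1 (S *m p.2)).
  apply: (measurableT_comp mF); apply: measurable_fun_cons_cV => //.
  apply: measurable_fun_addmx; first by apply: measurable_fun_scalemx; exact: measurable_funM.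
  exact: measurable_fun_mulmx.
have mH y : measurable_fun setT (H y).
  apply: (measurableT_comp mF); apply: measurable_fun_cons_cV => //.
  exact: measurable_fun_addmx.
have mHS v : measurable_fun [set: R] (fun y => H y (S *m v)).
  exact: (measurable_fun_pair1 v mH2).
(* any function serves to extract the sign of det S *)
have [detS _] := IHd S (cst 0) spdS (measurable_cst _) (fun=> lexx _).
have detT : \det T = (a * \det S)%R.
  have -> : T = block_mx 1%:M 0 (a^-1 *: c) 1%:M *m block_mx a%:M c^T 0 S.
    rewrite mulmx_block !mul1mx !mul0mx !addr0 TE.
    rewrite mul_mx_scalar scalerA divff ?gt_eqF// scale1r.
    by rewrite -scalemxAl addrC.
  by rewrite det_mulmx (@det_lblock _ 1 d) (@det_ublock _ 1 d) !det1 !mul1r det_scalar1.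
have TF x v : F (T *m cons_cV (x, v))%R = H (a * x + (c^T *m v) ord0 ord0)%R (S *m v)%R.
  rewrite TE block_mx_cons_cV /H/=; congr (F (cons_cV (_, _))).
  rewrite mulrDl mulrAC divff ?gt_eqF// mul1r scalerDl -addrA; congr +%R.
  rewrite mulmxDl addrC; congr +%R.
  rewrite -scalemxAl -mulmxA [X in c *m X]mx11_scalar mul_mx_scalar scalerA.
  by rewrite mulrC.
split; first by rewrite detT mulr_gt0.
rewrite integral_lebesgue_cons_sym//; last first.
  by apply: (measurableT_comp mF); exact: measurable_fun_mulmx.
under eq_integral => v _ do under eq_integral => x _ do rewrite TF.
under eq_integral => v _.
  rewrite (ge0_integral_affine _ a0 (mHS v) (fun=> F0 _)).
  over.
rewrite ge0_integralZl//; first last.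
- by rewrite lee_fin invr_ge0 ltW.
- by move=> v _; apply: integral_ge0 => y _; exact: F0.
- exact: (measurable_fun_fubini_tonelli_G (fun p : measurableTypeR R * 'cV[R]_d => H p.1 (S *m p.2)) mH2 (fun=> F0 _)).
rewrite -(fubini_tonelli (fun p : measurableTypeR R * 'cV[R]_d => H p.1 (S *m p.2)) mH2 (fun=> F0 _)).
under eq_integral => y _.
  rewrite (IHd S (H y) spdS (mH y) (fun=> F0 _)).2.
  rewrite (ge0_integral_cV_translation _ (F := fun v => F (cons_cV (y, v))))//; last first.
    by apply: (measurableT_comp mF); exact: measurable_fun_cons_cV.
  over.
rewrite ge0_integralZl//; first last.
- by rewrite lee_fin invr_ge0 ltW.
- by move=> v _; apply: integral_ge0 => y _; exact: F0.
- exact: measurable_integral_lebesgue_cons.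
by rewrite muleA -EFinM -invfM -detT integral_lebesgue_cons.
Qed.

End lebesgue_vectors.

(** * One-dimensional Gaussian moments *)

Section gauss_line.
Context {R : realType}.
Local Notation leb := (@lebesgue_measure R).
Local Open Scope ereal_scope.
Local Notation s2pi := (Num.sqrt (2 * pi) : R)%R.

Definition gauss (x : R) : R := expR (- (2^-1 * x ^+ 2)).

Lemma gauss_ge0 x : (0 <= gauss x)%R. Proof. exact: expR_ge0. Qed.

Lemma measurable_gauss : measurable_fun setT gauss.
Proof.
apply: measurableT_comp => //; apply: measurableT_comp => //.
by apply: measurable_funM => //; exact: measurable_funX.
Qed.

Lemma integral_gauss_scaled (r : R) : (0 < r)%R ->
  \int[leb]_x (gauss (x / r))%:E = (r * s2pi)%:E.
Proof.
move=> r0; have s20 : (0 < Num.sqrt 2 :> R)%R by rewrite sqrtr_gt0.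
have k0 : (0 < (Num.sqrt 2 * r)^-1)%R by rewrite invr_gt0 mulr_gt0.
transitivity (\int[leb]_x (gauss_fun ((Num.sqrt 2 * r)^-1 * x + 0))%:E).
  apply: eq_integral => x _; rewrite /gauss /gauss_fun addr0; congr (expR (- _))%:E.
  by rewrite invfM !exprMn !exprVn sqr_sqrtr// mulrA mulrAC.
rewrite (ge0_integral_affine 0 k0 (F := fun x => (gauss_fun x)%:E)).
- by rewrite integralT_gauss invrK -EFinM sqrtrM ?ler0n// mulrCA mulrA.
- apply/measurable_EFinP. exact: measurable_gauss_fun.
- by move=> x; rewrite lee_fin gauss_fun_ge0.
Qed.

Lemma integral_gauss : \int[leb]_x (gauss x)%:E = s2pi%:E.
Proof.
rewrite -[in RHS](mul1r s2pi) -integral_gauss_scaled//.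
by apply: eq_integral => x _; rewrite divr1.
Qed.

(** For [r > 1] and [t = (1 - 1 / r^2) / 2], the inequality
    [1 + t x^2 <= exp (t x^2)] multiplied by the Gaussian [exp (- x^2 / 2)] is
    dominated by the Gaussian of standard deviation [r], whose integral is
    [r] times that of the standard one.  This bounds the second moment by
    [(r - 1) / t = 2 r^2 / (r + 1)] times the mass, and [r] may tend to 1. *)
Lemma integral_sqr_gauss_le : \int[leb]_x (x ^+ 2 * gauss x)%:E <= s2pi%:E.
Proof.
have bound (r : R) : (1 < r)%R ->
    \int[leb]_x (x ^+ 2 * gauss x)%:E <= (2 * r ^+ 2 / (r + 1) * s2pi)%:E.
  move=> r1; have r0 : (0 < r)%R by exact: lt_trans r1.
  pose t := ((1 - r ^- 2) / 2)%R.
  have t0 : (0 < t)%R.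
    by rewrite divr_gt0// subr_gt0 invf_lt1 ?exprn_gt0// exprn_egt1.
  have mx2g : measurable_fun setT (fun x : R => x ^+ 2 * gauss x)%R.
    by apply: measurable_funM; [exact: measurable_funX|exact: measurable_gauss].
  have x2g0 x : (0 <= x ^+ 2 * gauss x)%R by rewrite mulr_ge0 ?sqr_ge0 ?gauss_ge0.
  have : t%:E * \int[leb]_x (x ^+ 2 * gauss x)%:E + s2pi%:E <= (r * s2pi)%:E.
    rewrite -integral_gauss -ge0_integralZl//; first last.
    - by rewrite lee_fin ltW.
    - by move=> x _; rewrite lee_fin.
    - exact/measurable_EFinP.
    rewrite -ge0_integralD//; first last.
    - by apply/measurable_EFinP; exact: measurable_gauss.
    - by move=> x _; rewrite lee_fin gauss_ge0.
    - by apply: measurable_funeM; exact/measurable_EFinP.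
    - by move=> x _; rewrite -EFinM lee_fin mulr_ge0// ltW.
    rewrite -(integral_gauss_scaled r0); apply: ge0_le_integral => //.
    - move=> x _; rewrite -EFinM -EFinD lee_fin addr_ge0 ?gauss_ge0//.
      by rewrite mulr_ge0// ltW.
    - apply/measurable_EFinP; apply: measurable_funD; last exact: measurable_gauss.
      exact: measurable_funM.
    - apply/measurable_EFinP; apply: (measurableT_comp measurable_gauss).
      exact: measurable_funM.
    move=> x _; rewrite -EFinM -EFinD lee_fin.
    have -> : gauss (x / r) = (expR (t * x ^+ 2) * gauss x)%R.
      rewrite /gauss -expRD; congr expR; rewrite /t; field; rewrite gt_eqF//.
    rewrite mulrA -[X in (_ + X)%R]mul1r -mulrDl ler_wpM2r ?gauss_ge0//.
    by rewrite addrC expR_ge1Dx.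
  have : 0 <= \int[leb]_x (x ^+ 2 * gauss x)%:E by apply: integral_ge0 => x _; rewrite lee_fin.
  case: (\int[leb]_x _) => [u| |] // u0; last by rewrite gt0_muley ?lte_fin// addye.
  rewrite -EFinM -EFinD !lee_fin => h.
  have : (t * u <= (r - 1) * s2pi)%R by lra.
  rewrite -ler_pdivlMl// => /le_trans; apply.
  rewrite mulrA le_eqVlt; apply/orP; left; apply/eqP; congr (_ * _)%R.
  rewrite /t; field.
  do ?[apply/andP; split]; rewrite ?gt_eqF//; try nra.
apply/lee_addgt0Pr => e e0.
have s0 : (0 < s2pi)%R by rewrite sqrtr_gt0 mulr_gt0 ?pi_gt0.
(* for d <= 1, 2 (1 + d)^2 / (2 + d) <= 1 + 3 d *)
pose d := Num.min 1%R (e / (3 * s2pi))%R.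
have d0 : (0 < d)%R by rewrite lt_min ltr01 divr_gt0// mulr_gt0.
have d1 : (d <= 1)%R by rewrite ge_min lexx.
have de : (3 * d * s2pi <= e)%R.
  by rewrite mulrAC mulrC -ler_pdivlMr ?mulr_gt0// ge_min lexx orbT.
apply: (le_trans (bound (1 + d)%R _)); first by rewrite ltrDl.
rewrite -EFinD lee_fin.
have : (2 * (1 + d) ^+ 2 / ((1 + d) + 1) <= 1 + 3 * d)%R.
  by rewrite ler_pdivrMr; nra.
move=> /(ler_wpM2r (ltW s0)) /le_trans; apply; lra.
Qed.

(** The cross term [2 a b x] has mean zero; to remain within nonnegative
    functions, the integrand is averaged with its image under [x -> - x]. *)
Lemma integral_affine_sqr_gauss_le (a b : R) :
  \int[leb]_x ((a + b * x) ^+ 2 * gauss x)%:E <= ((a ^+ 2 + b ^+ 2) * s2pi)%:E.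
Proof.
pose I b := \int[leb]_x ((a + b * x) ^+ 2 * gauss x)%:E.
have mI (c : R) : measurable_fun setT (fun x : R => ((a + c * x) ^+ 2 * gauss x)%:E).
  apply/measurable_EFinP; apply: measurable_funM; last exact: measurable_gauss.
  by apply: measurable_funX; apply: measurable_funD => //; exact: measurable_funM.
have I0 (c x : R) : 0 <= ((a + c * x) ^+ 2 * gauss x)%:E.
  by rewrite lee_fin mulr_ge0 ?gauss_ge0 ?sqr_ge0.
have x2g0 x : (0 <= x ^+ 2 * gauss x)%R by rewrite mulr_ge0 ?sqr_ge0 ?gauss_ge0.
have mx2g : measurable_fun setT (fun x : R => x ^+ 2 * gauss x)%R.
  by apply: measurable_funM; [exact: measurable_funX|exact: measurable_gauss].
have c0 (c : R) : (0 <= 2 * c ^+ 2)%R by rewrite mulr_ge0 ?sqr_ge0.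
have IN : I b = I (- b)%R.
  rewrite /I -(ge0_integral_opp (mI b) (I0 b)); apply: eq_integral => x _.
  by rewrite /gauss sqrrN mulrN mulNr.
have : 2%:E * I b <= 2%:E * ((a ^+ 2 + b ^+ 2) * s2pi)%:E.
  rewrite mule_natl mule2n {2}IN /I -ge0_integralD//; first last.
  - exact: mI.
  - exact: mI.
  under eq_integral => x _.
    rewrite -EFinD (_ : _ + _ =
      2 * a ^+ 2 * gauss x + 2 * b ^+ 2 * (x ^+ 2 * gauss x))%R; last by ring.
    rewrite EFinD !(EFinM (2 * _)).
    over.
  rewrite ge0_integralD//; first last.
  - by apply: measurable_funeM; exact/measurable_EFinP.
  - by move=> x _; rewrite mule_ge0// lee_fin.
  - by apply: measurable_funeM; apply/measurable_EFinP; exact: measurable_gauss.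
  - by move=> x _; rewrite mule_ge0// lee_fin// gauss_ge0.
  rewrite !ge0_integralZl//; first last.
  - by rewrite lee_fin.
  - by move=> x _; rewrite lee_fin gauss_ge0.
  - by apply/measurable_EFinP; exact: measurable_gauss.
  - by rewrite lee_fin.
  - by move=> x _; rewrite lee_fin.
  - exact/measurable_EFinP.
  have -> : 2%:E * ((a ^+ 2 + b ^+ 2) * s2pi)%:E =
      (2 * a ^+ 2)%:E * s2pi%:E + (2 * b ^+ 2)%:E * s2pi%:E.
    by rewrite -!EFinM -EFinD; congr EFin; ring.
  rewrite integral_gauss leeD2l//.
  by apply: lee_wpmul2l; [rewrite lee_fin|exact: integral_sqr_gauss_le].
by rewrite lee_pmul2l// lte_fin.
Qed.

End gauss_line.

(** * Multivariate Gaussian moments *)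

Section gauss_vectors.
Context {R : realType}.
Local Notation leb := (@lebesgue_measure R).
Local Open Scope ereal_scope.
Local Notation s2pi := (Num.sqrt (2 * pi) : R)%R.

Definition gauss_cV d (z : 'cV[R]_d) : R :=
  expR (- (2^-1 * \sum_i z i ord0 ^+ 2)).

Lemma gauss_cV_ge0 d (z : 'cV[R]_d) : (0 <= gauss_cV z)%R.
Proof. exact: expR_ge0. Qed.

Lemma measurable_gauss_cV d : measurable_fun setT (@gauss_cV d).
Proof.
apply: measurableT_comp => //; apply: measurableT_comp => //.
by apply: measurable_funM => //; exact: measurable_fun_enorm2.
Qed.

Lemma gauss_cons_cV d x (v : 'cV[R]_d) :
  gauss_cV (cons_cV (x, v)) = (gauss x * gauss_cV v)%R.
Proof.
rewrite /gauss_cV /gauss -expRD big_ord_recl cons_cV0 mulrDr opprD.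
by under eq_bigr do rewrite cons_cV_lift.
Qed.

Lemma measurable_affine_sqr_gauss_cV d (a : R) (t : 'I_d -> R) :
  measurable_fun setT (fun z : 'cV[R]_d =>
    ((a + \sum_i t i * z i ord0) ^+ 2 * gauss_cV z)%:E).
Proof.
apply/measurable_EFinP; apply: measurable_funM; last exact: measurable_gauss_cV.
apply: measurable_funX; apply: measurable_funD => //; apply: measurable_sum => i.
by apply: measurable_funM => //; exact: measurable_fun_coord.
Qed.

(** Integrating out all variables but the first, the affine function
    [a + t_0 x] of the first variable plays the role of the constant [a] in the
    induction hypothesis.  With [t = 0] and [a = 1] the lemma bounds the mass of
    the Gaussian. *)
Lemma integral_affine_sqr_gauss_cV_le d (a : R) (t : 'I_d -> R) :
  \int[lebesgue_cV d]_z ((a + \sum_i t i * z i ord0) ^+ 2 * gauss_cV z)%:E <=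
  ((a ^+ 2 + \sum_i t i ^+ 2) * s2pi ^+ d)%:E.
Proof.
have sq0 (y g : R) : (0 <= g)%R -> 0 <= (y ^+ 2 * g)%:E.
  by move=> g0; rewrite lee_fin mulr_ge0 ?sqr_ge0.
elim: d a t => [|d IHd] a t.
  rewrite big_ord0 addr0 expr0 mulr1 integral_dirac//; last first.
    exact: measurable_affine_sqr_gauss_cV.
  by rewrite /gauss_cV diracE mem_set// mul1e !big_ord0 mulr0 oppr0 expR0 mulr1 addr0.
rewrite integral_lebesgue_cons; first last.
- by move=> z; rewrite sq0 ?gauss_cV_ge0.
- exact: measurable_affine_sqr_gauss_cV.
pose t' (i : 'I_d) := t (lift ord0 i).
pose k : R := (s2pi ^+ d)%R; pose s : R := (\sum_i t' i ^+ 2)%R.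
have k0 : (0 <= k)%R by rewrite exprn_ge0 ?sqrtr_ge0.
have s0 : (0 <= s)%R by rewrite sumr_ge0// => i _; rewrite sqr_ge0.
have ms : measurable_fun [set: R] (fun x => ((a + t ord0 * x) ^+ 2 * gauss x)%:E).
  apply/measurable_EFinP; apply: measurable_funM; last exact: measurable_gauss.
  by apply: measurable_funX; apply: measurable_funD => //; exact: measurable_funM.
have mg : measurable_fun [set: R] (fun x : R => (gauss x)%:E).
  by apply/measurable_EFinP; exact: measurable_gauss.
apply: (@le_trans _ _ (\int[leb]_x (k%:E *
    (((a + t ord0 * x) ^+ 2 * gauss x)%:E + s%:E * (gauss x)%:E)))).
  apply: ge0_le_integral => //.
  - by move=> x _; apply: integral_ge0 => v _; rewrite sq0 ?gauss_cV_ge0.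
  - apply: (measurable_integral_lebesgue_cons
      (measurable_affine_sqr_gauss_cV a t)) => z.
    by rewrite sq0 ?gauss_cV_ge0.
  - by apply: measurable_funeM; apply: emeasurable_funD => //; exact: measurable_funeM.
  move=> x _.
  under eq_integral => v _.
    rewrite big_ord_recl cons_cV0 gauss_cons_cV /=.
    under eq_bigr do rewrite cons_cV_lift /=.
    rewrite addrA mulrCA EFinM.
    over.
  rewrite ge0_integralZl//; first last.
  - by rewrite lee_fin gauss_ge0.
  - by move=> v _; rewrite sq0 ?gauss_cV_ge0.
  - exact: (measurable_affine_sqr_gauss_cV _ t').
  apply: le_trans (lee_wpmul2l _ (IHd _ t')) _; first by rewrite lee_fin gauss_ge0.
  by rewrite -EFinM -EFinD -!EFinM lee_fin -/t' -/s -/k le_eqVlt; apply/orP; left; apply/eqP; ring.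
rewrite ge0_integralZl//; first last.
- by move=> x _; rewrite adde_ge0 ?sq0 ?mule_ge0 ?lee_fin ?gauss_ge0.
- by apply: emeasurable_funD => //; exact: measurable_funeM.
rewrite ge0_integralD//; first last.
- exact: measurable_funeM.
- by move=> x _; rewrite mule_ge0 ?lee_fin ?gauss_ge0.
- by move=> x _; rewrite sq0 ?gauss_ge0.
rewrite ge0_integralZl//; last by move=> x _; rewrite lee_fin gauss_ge0.
rewrite integral_gauss big_ord_recl (exprS s2pi) -/k -/s.
apply: (@le_trans _ _ (k%:E * (((a ^+ 2 + t ord0 ^+ 2) * s2pi)%:E + s%:E * s2pi%:E))).
  by apply: lee_wpmul2l; rewrite ?lee_fin// leeD2r// integral_affine_sqr_gauss_le.
rewrite -EFinM lee_fin le_eqVlt; apply/orP; left; apply/eqP.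
by rewrite -/t' -/s; ring.
Qed.

Lemma enorm_sqr d (v : 'cV[R]_d) : (enorm v ^+ 2 = \sum_i v i ord0 ^+ 2)%R.
Proof. by rewrite sqr_sqrtr// sumr_ge0// => i _; rewrite sqr_ge0. Qed.

Lemma gweight_gt0 d (v : 'cV[R]_d) : (0 < gweight v)%R.
Proof. by rewrite ltr_pwDl// sqr_ge0. Qed.

Lemma measurable_enorm_sqr d : measurable_fun setT (fun v : 'cV[R]_d => enorm v ^+ 2)%R.
Proof.
rewrite (_ : (fun _ => _) = fun v : 'cV[R]_d => \sum_i v i ord0 ^+ 2)%R.
  exact: measurable_fun_enorm2.
by apply/funext => v; rewrite enorm_sqr.
Qed.

Lemma measurable_gweight d : measurable_fun setT (@gweight R d).
Proof. by apply: measurable_funD => //; exact: measurable_enorm_sqr. Qed.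

Section gaussian_kernel.
Variables (d : nat) (Sigma : 'M[R]_d).
Hypothesis spdSigma : sym_posdefmx Sigma.

Definition gaussian_density (m u : 'cV[R]_d) : R :=
  ((Num.sqrt ((2 * pi) ^+ d * \det Sigma))^-1 *
  expR (- (2^-1 * wnorm Sigma (u - m) ^+ 2)))%R.

Definition gaussian_mean (m : 'cV[R]_d) (f : 'cV[R]_d -> R) : \bar R :=
  \int[lebesgue_cV d]_u (f u * gaussian_density m u)%:E.

Lemma gaussian_density_ge0 m u : (0 <= gaussian_density m u)%R.
Proof. by rewrite mulr_ge0 ?expR_ge0// invr_ge0 sqrtr_ge0. Qed.

Lemma measurable_gaussian_exponential disp (X : measurableType disp)
    (f g : X -> 'cV[R]_d) :
  measurable_fun setT f -> measurable_fun setT g ->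
  measurable_fun setT
    (fun x => expR (- (2^-1 * wnorm Sigma (g x - f x) ^+ 2)))%R.
Proof.
move=> mf mg; apply: measurableT_comp => //.
apply: measurableT_comp => //; apply: measurable_funM => //.
apply: (measurableT_comp (@measurable_enorm_sqr d)).
apply: measurable_fun_mulmx.
rewrite (_ : (fun _ => _) = fun x => g x + (- 1%:M) *m f x)%R; last first.
  by apply/funext => x; rewrite mulNmx mul1mx.
by apply: measurable_fun_addmx => //; exact: measurable_fun_mulmx.
Qed.

Lemma measurable_gaussian_density disp (X : measurableType disp)
    (f g : X -> 'cV[R]_d) :
  measurable_fun setT f -> measurable_fun setT g ->
  measurable_fun setT (fun x => gaussian_density (f x) (g x)).
Proof.
by move=> mf mg; apply: measurable_funM => //; exact: measurable_gaussian_exponential.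
Qed.

(** After the substitution [u = m + T z], where [T] is the square root of
    [Sigma], the weight [1 + |m + T z|^2] is a sum of [d + 1] squares of affine
    functions of [z], the first of them constant. *)
Lemma gaussian_mean_gweight_le m :
  gaussian_mean m (@gweight R d) <= (1 + enorm m ^+ 2 + \tr Sigma)%:E.
Proof.
have [spdT TT] := sqrtmxP spdSigma.
set T := sqrtmx Sigma in spdT TT.
pose h u : \bar R := (gweight u * gaussian_density m u)%:E.
have h0 u : 0 <= h u.
  by rewrite lee_fin mulr_ge0 ?gaussian_density_ge0// ltW// gweight_gt0.
have mh : measurable_fun setT h.
  apply/measurable_EFinP; apply: measurable_funM; first exact: measurable_gweight.
  exact: measurable_gaussian_density.
have mhm : measurable_fun setT (fun z => h (m + z)%R).
  by apply: (measurableT_comp mh); exact: measurable_fun_addmx.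
have [detT hT] := ge0_integral_cV_linear spdT mhm (fun=> h0 _).
have k0 : (0 < s2pi ^+ d)%R by rewrite exprn_gt0// sqrtr_gt0 mulr_gt0 ?pi_gt0.
have hE z : h (m + T *m z)%R =
    ((\det T * s2pi ^+ d)^-1)%:E * (gweight (m + T *m z) * gauss_cV z)%:E.
  rewrite /h /gaussian_density -/T -EFinM; congr EFin.
  have sqrt2pi : Num.sqrt ((2 * pi) ^+ d) = (s2pi ^+ d)%R.
    rewrite -{1}[(2 * pi)%R]sqr_sqrtr ?mulr_ge0 ?pi_ge0//.
    by rewrite exprAC sqrtr_sqr gtr0_norm.
  rewrite mulrCA; congr (_^-1 * (_ * expR (- (_ * _))))%R.
    rewrite -TT det_mulmx -expr2 sqrtrM ?exprn_ge0 ?mulr_ge0 ?pi_ge0//.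
    by rewrite sqrtr_sqr gtr0_norm// sqrt2pi mulrC.
  rewrite /wnorm addrAC subrr add0r mulKmx ?enorm_sqr//.
  by rewrite unitmxE unitfE gt_eqF.
rewrite /gaussian_mean -(ge0_integral_cV_translation m mh h0).
suff : \int[lebesgue_cV d]_z h (m + T *m z)%R <=
    (\det T)^-1%:E * (1 + enorm m ^+ 2 + \tr Sigma)%:E.
  by rewrite hT lee_pmul2l// lte_fin invr_gt0.
under eq_integral => z _ do rewrite hE.
have mg i : measurable_fun setT (fun z : 'cV[R]_d =>
    ((m i ord0 + \sum_j T i j * z j ord0) ^+ 2 * gauss_cV z)%:E).
  exact: measurable_affine_sqr_gauss_cV.
have m1 : measurable_fun setT (fun z : 'cV[R]_d =>
    ((1 + \sum_(j < d) 0 * z j ord0) ^+ 2 * gauss_cV z)%:E).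
  exact: measurable_affine_sqr_gauss_cV.
have g0 (y : R) (z : 'cV[R]_d) : 0 <= (y ^+ 2 * gauss_cV z)%:E.
  by rewrite lee_fin mulr_ge0 ?sqr_ge0 ?gauss_cV_ge0.
under eq_integral => z _.
  rewrite (_ : (gweight _ * _)%:E =
    ((1 + \sum_(j < d) 0 * z j ord0) ^+ 2 * gauss_cV z)%:E +
    \sum_i ((m i ord0 + \sum_j T i j * z j ord0) ^+ 2 * gauss_cV z)%:E); last first.
    rewrite big1 ?addr0 ?expr1n => [|j _]; last by rewrite mul0r.
    rewrite sumEFin -EFinD -mulr_suml -mulrDl; congr (((1 + _) * _)%:E).
    by rewrite enorm_sqr; apply: eq_bigr => i _; rewrite !mxE.
  over.
rewrite ge0_integralZl//; first last.
- by rewrite lee_fin invr_ge0 mulr_ge0// ltW.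
- by move=> z _; rewrite adde_ge0// sume_ge0.
- by apply: emeasurable_funD => //; exact: emeasurable_sum.
rewrite ge0_integralD//; first last.
- exact: emeasurable_sum.
- by move=> z _; rewrite sume_ge0.
rewrite ge0_integral_sum//.
apply: (@le_trans _ _ ((\det T * s2pi ^+ d)^-1%:E *
   (((1 ^+ 2 + \sum_(i < d) 0 ^+ 2) * s2pi ^+ d)%:E +
    \sum_(i < d) ((m i ord0 ^+ 2 + \sum_j T i j ^+ 2) * s2pi ^+ d)%:E))).
  apply: lee_wpmul2l; first by rewrite lee_fin invr_ge0 mulr_ge0// ltW.
  by apply: leeD; [|apply: lee_sum => i _]; exact: integral_affine_sqr_gauss_cV_le.
have trE : \tr Sigma = (\sum_i \sum_j T i j ^+ 2)%R.
  rewrite -TT; apply: eq_bigr => i _; rewrite mxE; apply: eq_bigr => j _.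
  by rewrite -{2}spdT.1 mxE.
rewrite sumEFin -EFinD -!EFinM lee_fin [X in (1 ^+ 2 + X)%R]big1 => [|i _]; last by rewrite expr0n.
rewrite -mulr_suml -mulrDl big_split/= -trE -enorm_sqr expr1n addr0 addrA.
rewrite le_eqVlt; apply/orP; left; apply/eqP; field.
by rewrite !gt_eqF.
Qed.

End gaussian_kernel.
End gauss_vectors.

(** * Integration against a measure with a density *)

Section density.
Context {R : realType} {disp : measure_display} {T : measurableType disp}.
Variables (mu nu : {measure set T -> \bar R}) (f : T -> \bar R).
Hypotheses (mf : measurable_fun setT f) (f0 : forall x, (0 <= f x)%E)
  (f_fin : forall x, f x \is a fin_num).
Hypothesis nuE : forall A, measurable A -> (nu A = \int[mu]_(x in A) f x)%E.
Local Open Scope ereal_scope.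

Import HBNNSimple.

Let integral_density_nnsfun (h : {nnsfun T >-> R}) :
  \int[nu]_x (h x)%:E = \int[mu]_x ((h x)%:E * f x).
Proof.
have hE x : (h x)%:E * f x =
    \sum_(r \in range h) (r * \1_(h @^-1` [set r]) x)%:E * f x.
  rewrite {1}fimfunE -fsumEFin// ge0_mule_fsuml// => r.
  exact: nnfun_muleindic_ge0.
rewrite integralT_nnsfun sintegralE.
under [RHS]eq_integral do rewrite hE.
rewrite ge0_integral_fsum//; last 2 first.
- move=> r; apply: emeasurable_funM => //; apply/measurable_EFinP.
  exact: measurable_funM.
- by move=> r x _; rewrite mule_ge0// nnfun_muleindic_ge0.
apply: eq_fsbigr => r /[!inE] -[t _ <-].
under eq_integral do rewrite EFinM -muleA.
rewrite ge0_integralZl ?lee_fin//; first last.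
- by move=> x _; rewrite mule_ge0// lee_fin.
- by apply: emeasurable_funM => //; exact/measurable_EFinP.
rewrite nuE// integral_mkcond; congr (_ * _); apply: eq_integral => x _.
by rewrite epatch_indic muleC.
Qed.

(** Finiteness of the density makes the multiplication by [f x] continuous, so
    that the monotone approximation of [g] by simple functions passes to the
    limit on both sides. *)
Lemma ge0_integral_density (g : T -> \bar R) :
  measurable_fun setT g -> (forall x, 0 <= g x) ->
  \int[nu]_x g x = \int[mu]_x (g x * f x).
Proof.
move=> mg g0; pose h := nnsfun_approx measurableT mg.
have h_cvg x : (h n x)%:E @[n --> \oo] --> g x by exact: cvg_nnsfun_approx.
have h_mono x : {homo (fun n => h n x) : m n / (m <= n)%N >-> (m <= n)%R}.
  by move=> m n mn; exact/lefP/nd_nnsfun_approx.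
transitivity (limn (fun n => \int[nu]_x (h n x)%:E)).
  rewrite -monotone_convergence//.
  - by apply: eq_integral => x _; apply/esym/cvg_lim.
  - by move=> n; exact/measurable_EFinP.
  - by move=> n x _; rewrite lee_fin.
  - by move=> x _ m n mn; rewrite lee_fin h_mono.
under eq_fun do rewrite integral_density_nnsfun.
rewrite -monotone_convergence//.
- apply: eq_integral => x _; apply/cvg_lim => //.
  by apply: cvgeZr => //; exact: f_fin.
- by move=> n; apply: emeasurable_funM => //; exact/measurable_EFinP.
- by move=> n x _; rewrite mule_ge0// lee_fin.
- by move=> x _ m n mn; rewrite lee_wpmul2r// lee_fin h_mono.
Qed.

End density.

(** * The transition operator *)

Section transition.
Context {R : realType}.
Local Open Scope ereal_scope.
Variables (d : nat) (Sigma : 'M[R]_d) (Psi : {mfun 'cV[R]_d >-> 'cV[R]_d}).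

Local Notation density := (gaussian_density Sigma).

Let mPsi : measurable_fun setT Psi. Proof. exact: measurable_funPT. Qed.

Lemma markovP_densityE (mu : probability 'cV[R]_d R) u :
  markovP_density Sigma Psi mu u = \int[mu]_v (density (Psi v) u)%:E.
Proof.
rewrite /markovP_density -ge0_integralZl//.
by apply/measurable_EFinP; exact: measurable_gaussian_exponential.
Qed.

Lemma markovP_density_fin_num (mu : probability 'cV[R]_d R) u :
  markovP_density Sigma Psi mu u \is a fin_num.
Proof.
rewrite ge0_fin_numE ?markovP_density_ge0// markovP_densityE.
apply: (@le_lt_trans _ _ (\int[mu]_v
    ((Num.sqrt ((2 * pi) ^+ d * \det Sigma))^-1)%:E)); last first.
  by rewrite integral_cst//= probability_setT mule1 ltry.
apply: ge0_le_integral => //.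
- by move=> v _; rewrite lee_fin gaussian_density_ge0.
- by apply/measurable_EFinP; exact: measurable_gaussian_density.
- move=> v _; rewrite lee_fin ler_piMr ?invr_ge0 ?sqrtr_ge0//.
  by rewrite expR_le1 oppr_le0 mulr_ge0 ?sqr_ge0.
Qed.

Section nonneg.
Variable f : 'cV[R]_d -> R.
Hypotheses (mf : measurable_fun setT f) (f0 : forall u, (0 <= f u)%R).

Let F (p : 'cV[R]_d * 'cV[R]_d) := (f p.2 * density (Psi p.1) p.2)%:E.

Let mF : measurable_fun setT F.
Proof.
apply/measurable_EFinP; apply: measurable_funM; first exact: measurableT_comp.
by apply: measurable_gaussian_density => //; exact: measurableT_comp.
Qed.

Let F0 p : 0 <= F p.
Proof. by rewrite lee_fin mulr_ge0 ?gaussian_density_ge0. Qed.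

Lemma measurable_gaussian_mean :
  measurable_fun setT (fun v => gaussian_mean Sigma (Psi v) f).
Proof. exact: (measurable_fun_fubini_tonelli_F F mF F0). Qed.

Lemma ge0_integral_markovP (mu : probability 'cV[R]_d R) :
  \int[markovP Sigma Psi mu]_u (f u)%:E = \int[mu]_v gaussian_mean Sigma (Psi v) f.
Proof.
rewrite (@ge0_integral_density _ _ _ (lebesgue_cV d) _ (markovP_density Sigma Psi mu))//.
- rewrite (fubini_tonelli F mF F0); apply: eq_integral => u _.
  rewrite markovP_densityE -ge0_integralZl//.
  + by apply/measurable_EFinP; exact: measurable_gaussian_density.
  + by move=> v _; rewrite lee_fin gaussian_density_ge0.
  + by rewrite lee_fin.
- exact: measurable_markovP_density.
- by move=> u; exact: markovP_density_ge0.
- by move=> u; exact: markovP_density_fin_num.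
- exact/measurable_EFinP.
Qed.

End nonneg.

Variables (kappa : R).
Hypotheses (spdSigma : sym_posdefmx Sigma)
  (Psi_le : forall u : 'cV[R]_d, (enorm (Psi u) <= kappa)%R).

Local Notation K := (1 + kappa ^+ 2 + \tr Sigma)%R.

Lemma gaussian_mean_Psi_gweight_le v :
  gaussian_mean Sigma (Psi v) (@gweight R d) <= K%:E.
Proof.
apply: le_trans (gaussian_mean_gweight_le spdSigma (Psi v)) _.
rewrite lee_fin lerD2r lerD2l ler_sqr ?nnegrE ?sqrtr_ge0//.
exact: le_trans (sqrtr_ge0 _) (Psi_le v).
Qed.

(** The function [q] is [v |-> E[f(U)]] for [U] Gaussian of mean [Psi v] and
    covariance [Sigma].  That one [q] serves all measures [mu] is what makes the
    contraction argument work. *)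
Lemma integral_markovP_bounded (f : 'cV[R]_d -> R) :
  measurable_fun setT f -> (forall u, (`|f u| <= gweight u)%R) ->
  exists q : 'cV[R]_d -> R,
    [/\ measurable_fun setT q, (forall v, (`|q v| <= K)%R) &
    forall mu : probability 'cV[R]_d R,
      \int[markovP Sigma Psi mu]_u (f u)%:E = \int[mu]_v (q v)%:E].
Proof.
move=> mf f_le.
pose p u : R := (Num.max (f u) 0)%R; pose n u : R := (Num.max (- f u) 0)%R.
have p0 u : (0 <= p u)%R by rewrite le_max lexx orbT.
have n0 u : (0 <= n u)%R by rewrite le_max lexx orbT.
have mp : measurable_fun setT p by exact: measurable_maxr.
have mn : measurable_fun setT n.
  by apply: measurable_maxr => //; exact: measurableT_comp.
have pn_le u : (p u + n u <= gweight u)%R.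
  apply: le_trans (f_le u); rewrite /p /n.
  have [fu|/ltW fu] := leP 0%R (f u).
    by rewrite ger0_norm// max_r ?oppr_le0// addr0.
  by rewrite ler0_norm// max_l ?oppr_ge0// add0r.
have mQ (h : 'cV[R]_d -> R) : measurable_fun setT h -> (forall u, 0 <= h u)%R ->
    measurable_fun setT (fun v => gaussian_mean Sigma (Psi v) h).
  exact: measurable_gaussian_mean.
have Q0 (h : 'cV[R]_d -> R) v : (forall u, 0 <= h u)%R -> 0 <= gaussian_mean Sigma (Psi v) h.
  by move=> h0; apply: integral_ge0 => u _; rewrite lee_fin mulr_ge0 ?gaussian_density_ge0.
have mden v (h : 'cV[R]_d -> R) : measurable_fun setT h ->
    measurable_fun setT (fun u => (h u * density (Psi v) u)%:E).
  move=> mh; apply/measurable_EFinP; apply: measurable_funM => //.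
  exact: measurable_gaussian_density.
have QD v : gaussian_mean Sigma (Psi v) p + gaussian_mean Sigma (Psi v) n <= K%:E.
  apply: le_trans (gaussian_mean_Psi_gweight_le v).
  rewrite /gaussian_mean -ge0_integralD//; first last.
  - exact: mden.
  - by move=> u _; rewrite lee_fin mulr_ge0 ?gaussian_density_ge0.
  - exact: mden.
  - by move=> u _; rewrite lee_fin mulr_ge0 ?gaussian_density_ge0.
  apply: ge0_le_integral => //.
  - by move=> u _; rewrite -EFinD -mulrDl lee_fin mulr_ge0 ?addr_ge0 ?gaussian_density_ge0.
  - by apply: emeasurable_funD; exact: mden.
  - by apply: mden; exact: measurable_gweight.
  - by move=> u _; rewrite -EFinD -mulrDl lee_fin ler_wpM2r ?gaussian_density_ge0.
have Qp v : gaussian_mean Sigma (Psi v) p = (fine (gaussian_mean Sigma (Psi v) p))%:E.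
  rewrite fineK// ge0_fin_numE ?Q0//; apply: le_lt_trans (ltry K).
  by apply: le_trans (QD v); rewrite leeDl// Q0.
have Qn v : gaussian_mean Sigma (Psi v) n = (fine (gaussian_mean Sigma (Psi v) n))%:E.
  rewrite fineK// ge0_fin_numE ?Q0//; apply: le_lt_trans (ltry K).
  by apply: le_trans (QD v); rewrite leeDr// Q0.
pose qp v := fine (gaussian_mean Sigma (Psi v) p).
pose qn v := fine (gaussian_mean Sigma (Psi v) n).
have mqp : measurable_fun setT qp.
  by apply/measurable_EFinP; apply: eq_measurable_fun (mQ p mp p0) => v _; rewrite /= -Qp.
have mqn : measurable_fun setT qn.
  by apply/measurable_EFinP; apply: eq_measurable_fun (mQ n mn n0) => v _; rewrite /= -Qn.
have qp0 v : (0 <= qp v)%R by rewrite fine_ge0// Q0.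
have qn0 v : (0 <= qn v)%R by rewrite fine_ge0// Q0.
have q_le v : (qp v + qn v <= K)%R.
  by have := QD v; rewrite Qp Qn -EFinD lee_fin.
exists (fun v => qp v - qn v)%R; split.
- exact: measurable_funB.
- by move=> v; have := q_le v; have := qp0 v; have := qn0 v; rewrite ler_norml; lra.
move=> mu.
have int (h : 'cV[R]_d -> R) : measurable_fun setT h -> (forall v, 0 <= h v <= K)%R ->
    mu.-integrable setT (EFin \o h).
  move=> mh hK; apply: measurable_bounded_integrable => //.
    by rewrite (le_lt_trans (probability_le1 mu measurableT))// ltry.
  exists K; split; rewrite ?num_real// => y Ky v _ /=.
  have /andP[h0 hle] := hK v.
  by rewrite ger0_norm//; apply: le_trans hle (ltW Ky).
under [RHS]eq_integral do rewrite EFinB.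
rewrite integralB_EFin//; first last.
- by apply: int => // v; have := q_le v; have := qp0 v; have := qn0 v; lra.
- by apply: int => // v; have := q_le v; have := qp0 v; have := qn0 v; lra.
rewrite [LHS]integralE; congr (_ - _).
- transitivity (\int[mu]_v gaussian_mean Sigma (Psi v) p); last first.
    by apply: eq_integral => v _; rewrite Qp.
  rewrite -ge0_integral_markovP//; apply: eq_integral => u _.
  by rewrite funeposE EFin_max.
- transitivity (\int[mu]_v gaussian_mean Sigma (Psi v) n); last first.
    by apply: eq_integral => v _; rewrite Qn.
  rewrite -ge0_integral_markovP//; apply: eq_integral => u _.
  by rewrite funenegE EFin_max.
Qed.

End transition.

Theorem lemma23 (R : realType) (d : nat) (Sigma : 'M[R]_d)
    (hSigma : sym_posdefmx Sigma)
    (Psi : {mfun 'cV[R]_d >-> 'cV[R]_d})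
    (kappa : R) (hkappa : 0 < kappa)
    (hPsi : forall u : 'cV[R]_d, enorm (Psi u) <= kappa)
    (mu nu : probability 'cV[R]_d R)
    (hmu : finite_second_moment mu) (hnu : finite_second_moment nu) :
  (d_g (markovP Sigma Psi mu) (markovP Sigma Psi nu) <=
   (1 + kappa ^+ 2 + \tr Sigma)%:E * d_g mu nu)%E.
Proof.
set K : R := 1 + kappa ^+ 2 + \tr Sigma.
apply: ge_ereal_sup => _ [f [mf f_le] <-].
have [q [mq q_le Pq]] := integral_markovP_bounded hSigma hPsi mf f_le.
have K0 : 0 < K.
  have [[symT _] TT] := sqrtmxP hSigma.
  rewrite /K -addrA ltr_pwDl// addr_ge0 ?sqr_ge0// -TT sumr_ge0// => i _.
  rewrite mxE sumr_ge0// => j _.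
  by rewrite -{2}symT mxE -expr2 sqr_ge0.
(* the competitor for d_g mu nu *)
pose h v := K^-1 * q v.
have h_le1 v : `|h v| <= 1.
  by rewrite normrM gtr0_norm ?invr_gt0// ler_pdivrMl// mulr1 q_le.
have mh : measurable_fun setT h by exact: measurable_funM.
have h_int (m : probability 'cV[R]_d R) : m.-integrable setT (EFin \o h).
  apply: measurable_bounded_integrable => //.
    by rewrite (le_lt_trans (probability_le1 m measurableT))// ltry.
  exists 1; split; rewrite ?num_real// => y y1 v _ /=.
  by apply: le_trans (h_le1 v) (ltW y1).
have Ph (m : probability 'cV[R]_d R) :
    (\int[markovP Sigma Psi m]_u (f u)%:E = K%:E * \int[m]_v (h v)%:E)%E.
  rewrite Pq -(integralZl measurableT (h_int m)); apply: eq_integral => v _.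
  by rewrite -EFinM /h mulVKf// gt_eqF.
have h_fin (m : probability 'cV[R]_d R) : (\int[m]_v (h v)%:E)%E \is a fin_num.
  exact: (integrable_fin_num measurableT (h_int m)).
rewrite !Ph -muleBr//; last by rewrite fin_num_adde_defr.
have K0e : (0 <= K%:E)%E by rewrite lee_fin ltW.
rewrite abseM gee0_abs//; apply: lee_wpmul2l => //.
apply: ereal_sup_ubound; exists h => //; split=> // v.
by rewrite (le_trans (h_le1 v))// lerDl sqr_ge0.
Qed.
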